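(* Let $\nu,k$ be integers with $2\nu-1\ge k\ge\nu-1\ge1$. Then $x=0$ is a zero of the polynomial $D(2\nu,k,x)$ of multiplicity exactly $N(2\nu,k)$.
   Context: For $n>k\ge1$ and $x\in\mathbb{R}$, $A(n,k,x)$ is the $n\times n$ skew-symmetric Toeplitz matrix whose first $k$ superdiagonals have all entries $1$ and whose remaining superdiagonal entries are all $-x$; $D(n,k,x)\in\mathbb{Z}[x]$ is its determinant. $N(n,k)$ is the nullity of $A(n,k,0)$. *)

(* Defs.v *)
From mathcomp Require Import all_boot all_order all_algebra.
Set Implicit Arguments. Unset Strict Implicit. Unset Printing Implicit Defensive.
Import GRing.Theory.
Local Open Scope ring_scope.

Definition sup_entry (R : pzRingType) (k : nat) (x : R) (d : nat) : R :=
  if (d <= k)%N then 1 else - x.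

Definition Amx (R : pzRingType) (n k : nat) (x : R) : 'M[R]_n :=
  \matrix_(i < n, j < n)
    if (i < j)%N then sup_entry k x (j - i)
    else if (j < i)%N then - sup_entry k x (i - j) else 0.

Definition Dpoly (n k : nat) : {poly int} := \det (Amx n k 'X).

Definition Nnull (n k : nat) : nat := (n - \rank (Amx n k (0 : rat)))%N.

(* Main.v *)
(** Write A for A(n,k,0) and S for the sign matrix, so that A(n,k,x) = A + x(A - S). For a
    pencil A + xB the order of det at 0 is the nullity of A as soon as B pairs the left and
    right kernels of A nondegenerately; here A is skew, and on its kernel A - S acts as - S.

    In terms of the partial sums V of a vector, the kernel equations read
    V(min(n,i+k+1)) + V(i-k) = V(i) + V(i+1). Put m = n-1-k; since n is even, k+1-m is even,
    say 2r. With a = V(1) and t = V(n), they force V to repeat 0, a, t-a on [0,m], to alternate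
    a, t-a on [m,k+1], and to repeat a, t, t-a on [k+1,n]; compatibility at m and n
    gives a = t = 0 unless m = 1 mod 3, in which case a and t are free. In partial sums, S is
    the discrete area form, and in the coordinates (a,t) it is 2(m div 3)+1 times the
    determinant, hence nondegenerate. *)
Require Import Defs.
From mathcomp Require Import all_boot all_order all_algebra.
From mathcomp Require Import zify ring.
Set Implicit Arguments. Unset Strict Implicit. Unset Printing Implicit Defensive.
Import GRing.Theory Num.Theory.
Local Open Scope ring_scope.

(** * Order of vanishing of the determinant of a linear matrix pencil *)

Lemma unitmx_ker0 (F : fieldType) (n : nat) (M : 'M[F]_n) :
  (forall z : 'cV_n, M *m z = 0 -> z = 0) -> M \in unitmx.
Proof.
move=> inj; rewrite -unitmx_tr -row_free_unit -kermx_eq0.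
apply/eqP/row_matrixP => i; rewrite row0; apply: (can_inj (@trmxK _ _ _)).
rewrite trmx0; apply: inj; apply: (can_inj (@trmxK _ _ _)).
by rewrite trmx_mul trmxK trmx0 -row_mul mulmx_ker row0.
Qed.

(** In bases that turn [A] into [pid_mx r], a factor with determinant ['X^(n - r)] splits off on the
    left, and nondegeneracy says precisely that the cofactor is invertible at 0. *)
Lemma mup_det_pencil (F : fieldType) (n : nat) (A B : 'M[F]_n) :
  (forall w : 'cV_n, A *m w = 0 ->
     (forall v : 'rV_n, v *m A = 0 -> v *m B *m w = 0) -> w = 0) ->
  let D := \det (map_mx polyC A + 'X *: map_mx polyC B) in
  D != 0 /\ mup 0 D = (n - \rank A)%N.
Proof.
move=> nondeg.
set r : nat := \rank A; have ler : (r <= n)%N by exact: rank_leq_row.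
set L := col_ebase A; set U := row_ebase A.
have uL : L \in unitmx by exact: col_ebase_unit.
have uU : U \in unitmx by exact: row_ebase_unit.
have defA : L *m pid_mx r *m U = A by exact: mulmx_ebase.
pose C := invmx L *m B *m invmx U.
have defB : B = L *m C *m U by rewrite /C !mulmxA mulmxV // mul1mx mulmxKV.
clearbody C.
(* Pulling 'X out of the last n - r rows of pid_mx r + 'X *: C leaves M. *)
pose M := pid_mx r + ('X *: pid_mx r + copid_mx r) *m map_mx polyC C : 'M_n.
have M0 : map_mx (horner_eval 0) M = pid_mx r + copid_mx r *m C.
  rewrite map_mxD map_mxM map_mxD map_mxZ /= horner_evalE hornerX scale0r add0r.
  rewrite !map_pid_mx map_copid_mx -map_mx_comp; congr (_ + _ *m _).
  by apply/matrixP => i j; rewrite !mxE /= horner_evalE hornerC.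
(* A kernel vector [z] satisfies [pid_mx r *m z = 0] and [copid_mx r *m C *m z = 0] separately. The
   first puts [invmx U *m z] in the right kernel of [A], the second makes it orthogonal under [B] to
   the left kernel. *)
have uM0 : pid_mx r + copid_mx r *m C \in unitmx.
  apply: unitmx_ker0 => z Mz.
  have Pz : (pid_mx r : 'M_n) *m z = 0.
    have := congr1 (mulmx (pid_mx r : 'M_n)) Mz.
    by rewrite mulmx0 mulmxA mulmxDr pid_mx_id // mulmxA mul_pid_mx_copid // mul0mx addr0.
  have Cz : copid_mx r *m C *m z = 0 by move: Mz; rewrite mulmxDl Pz add0r.
  have Az : A *m (invmx U *m z) = 0.
    by rewrite -defA -!mulmxA (mulmxA U) mulmxV // mul1mx Pz mulmx0.
  suff: invmx U *m z = 0 by move/(congr1 (mulmx U)); rewrite mulmxA mulmxV // mul1mx mulmx0.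
  apply: nondeg Az _ => v vA.
  have vLP : v *m L *m (pid_mx r : 'M_n) = 0.
    move/(congr1 (mulmx^~ (invmx U))): vA.
    by rewrite -defA !mulmxA mulmxK // mul0mx.
  have -> : v *m B *m (invmx U *m z) = v *m L *m (copid_mx r *m C *m z).
    rewrite defB -[RHS]add0r -{1}(mul0mx _ (C *m z)) -vLP -!mulmxA -!mulmxDr.
    rewrite -mulmxDl /copid_mx addrC subrK mul1mx.
    by rewrite (mulmxA U) mulmxV // mul1mx.
  by rewrite Cz mulmx0.
have DM : map_mx polyC A + 'X *: map_mx polyC B
    = map_mx polyC L *m ((pid_mx r + 'X *: copid_mx r) *m M) *m map_mx polyC U.
  rewrite -{1}defA {1}defB !map_mxM map_pid_mx scalemxAl scalemxAr -mulmxDl -mulmxDr.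
  congr (_ *m _ *m _); rewrite /M.
  (* The factorisation uses only that [P] and [Q] are orthogonal idempotents with sum 1:
     [(P + X Q)(P + (X P + Q) C) = P + X C]. *)
  have PP : (pid_mx r : 'M_n) *m (pid_mx r : 'M_n) = pid_mx r :> 'M[{poly F}]_n by rewrite pid_mx_id.
  have PQ : (pid_mx r : 'M_n) *m copid_mx r = 0 :> 'M[{poly F}]_n by rewrite mul_pid_mx_copid.
  have QP : copid_mx r *m (pid_mx r : 'M_n) = 0 :> 'M[{poly F}]_n by rewrite mul_copid_mx_pid.
  have QQ : copid_mx r *m copid_mx r = copid_mx r :> 'M[{poly F}]_n.
    by rewrite copid_mx_id.
  have PDQ : pid_mx r + copid_mx r = 1%:M :> 'M[{poly F}]_n by rewrite addrC subrK.
  move: (pid_mx r) (copid_mx r) PP PQ QP QQ PDQ => P Q PP PQ QP QQ PDQ.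
  rewrite mulmxDr mulmxA !mulmxDl !mulmxDr -!scalemxAl -!scalemxAr PP PQ QP QQ.
  by rewrite !scaler0 !addr0 add0r -!scalemxAl -scalerDr -mulmxDl PDQ mul1mx.
have detP : \det (pid_mx r + 'X *: copid_mx r : 'M[{poly F}]_n) = 'X^(n - r).
  have -> : pid_mx r + 'X *: copid_mx r
      = diag_mx (\row_(i < n) if (i < r)%N then 1 else 'X) :> 'M[{poly F}]_n.
    apply/matrixP => i j; rewrite !mxE -(inj_eq val_inj) /=.
    by case: (val i == val j) => /=; case: (i < r)%N; rewrite /= ?mulr1n ?mulr0n; ring.
  rewrite det_diag (eq_bigr (fun i : 'I_n => if (i < r)%N then 1 else 'X)) => [|i _]; last by rewrite mxE.
  rewrite (bigID (fun i : 'I_n => (i < r)%N)) /= big1 => [|i ->//]; rewrite mul1r.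
  rewrite (eq_bigr (fun=> 'X)) => [|i /negbTE -> //]; rewrite prodr_const; congr (_ ^+ _).
  rewrite -[in RHS](card_ord n) -(cardC (fun i : 'I_n => (i < r)%N)).
  suff -> : #|(fun i : 'I_n => (i < r)%N)| = r by rewrite addKn; apply: eq_card.
  rewrite -[RHS]card_ord -(card_image (f := widen_ord ler)); last by move=> x y /(congr1 val) /= /val_inj.
  apply: eq_card => i; apply/idP/imageP => [lti|[x _ ->]]; last exact: ltn_ord x.
  by exists (Ordinal lti) => //; apply: val_inj.
move=> D.
have defD : D = (\det L * \det U)%:P * \det M * 'X^(n - r).
  by rewrite /D DM !det_mulmx detP !det_map_mx polyCM; ring.
have nzLU : \det L * \det U != 0.
  by move: uL uU; rewrite !unitmxE !unitfE mulf_eq0 negb_or => -> ->.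
have rM : ~~ root ((\det L * \det U)%:P * \det M) 0.
  rewrite rootM rootC negb_or nzLU /= /root -horner_evalE -det_map_mx M0.
  by move: uM0; rewrite unitmxE unitfE.
split; last by rewrite defD mupMr // -['X]subr0 -polyC0 mup_XsubCX eqxx.
rewrite defD mulf_neq0 ?expf_neq0 ?polyX_eq0 //.
by apply: contraNneq rM => ->; rewrite root0.
Qed.

(** * Kernel equations and sign form in terms of partial sums *)

Lemma sum_diff_if (R : comNzRingType) (V : nat -> R) (lo hi N : nat) : (lo <= hi)%N ->
  \sum_(j < N) (if (lo <= j < hi)%N then V j.+1 - V j else 0)
  = V (minn N hi) - V (minn N lo).
Proof.
move=> le_lh; elim: N => [|N IH]; first by rewrite big_ord0 !min0n subrr.
rewrite big_ord_recr /= {}IH.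
have [/andP[h1 h2]|h] := boolP (lo <= N < hi)%N.
  have -> : minn N.+1 hi = N.+1 by lia.
  have -> : minn N hi = N by lia.
  have -> : minn N lo = lo by lia.
  have -> : minn N.+1 lo = lo by lia.
  by rewrite addrC addrA subrK.
rewrite addr0; have [h1|h1] := boolP (N < lo)%N.
  have -> : minn N.+1 hi = N.+1 by lia.
  have -> : minn N hi = N by lia.
  have -> : minn N lo = N by lia.
  have -> : minn N.+1 lo = N.+1 by lia.
  by rewrite !subrr.
by congr (V _ - V _); lia.
Qed.

Definition diff_col (R : comNzRingType) (n : nat) (V : nat -> R) : 'cV[R]_n :=
  \col_(i < n) (V i.+1 - V i).

(** Row [i] is 1 on the window of [k] indices after [i] and -1 on the window of [k] indices before
    it, so both sums telescope; [minn] and the truncated subtraction clip the windows to the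
    matrix. *)
Lemma Amx0_diff_col (R : comNzRingType) (n k : nat) (V : nat -> R) (i : 'I_n) :
  (Amx n k 0 *m diff_col n V) i 0
  = V (minn n (i + k).+1) + V (i - k)%N - V i - V i.+1.
Proof.
have ltin := ltn_ord i; rewrite mxE.
transitivity
  (\sum_(j < n) (if (i.+1 <= j < (i + k).+1)%N then V j.+1 - V j else 0)
   - \sum_(j < n) (if (i - k <= j < i)%N then V j.+1 - V j else 0)).
  rewrite -sumrB; apply: eq_bigr => j _; rewrite !mxE /sup_entry oppr0.
  have [lij|lji|eij] := ltngtP i j.
  - have -> : ((i - k <= j) && false)%N = false by lia.
    rewrite subr0; case: ifP => h.
      by rewrite mul1r ifT //; lia.
    by rewrite mul0r ifF //; lia.
  - rewrite andbT /= sub0r; case: ifP => h.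
      by rewrite mulN1r ifT //; lia.
    by rewrite oppr0 mul0r ifF ?oppr0 //; lia.
  - by rewrite andbF mul0r subrr.
rewrite !sum_diff_if; try lia.
have -> : minn n i.+1 = i.+1 by lia.
have -> : minn n i = i by lia.
have -> : minn n (i - k) = (i - k)%N by lia.
ring.
Qed.

Lemma diff_colE (R : comNzRingType) (n : nat) (v : 'cV[R]_n) :
  v = diff_col n (fun i => \sum_(j < n | (j < i)%N) v j 0).
Proof.
apply/matrixP => i j; rewrite ord1 mxE (bigD1 i) //= -[LHS]addr0 -addrA.
congr (_ + _); apply/esym/eqP; rewrite subr_eq0; apply/eqP; apply: eq_bigl.
by move=> l /=; rewrite -(inj_eq val_inj) /=; lia.
Qed.

(* For n <= k every superdiagonal of Amx n k 0 is 1: it is the sign matrix S. *)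
Lemma pair_diff_col (R : comNzRingType) (n k : nat) (V W : nat -> R) :
  (n <= k)%N -> V 0%N = 0 -> W 0%N = 0 ->
  ((diff_col n W)^T *m Amx n k 0 *m diff_col n V) 0 0
  = \sum_(i < n) (W i * V i.+1 - W i.+1 * V i).
Proof.
move=> lenk V0 W0; rewrite -mulmxA mxE.
transitivity (\sum_(i < n) (W i.+1 - W i) * (V n - V i - V i.+1)).
  apply: eq_bigr => i _; rewrite Amx0_diff_col !mxE; have ltin := ltn_ord i.
  have -> : minn n (i + k).+1 = n by lia.
  have -> : (i - k)%N = 0%N by lia.
  by rewrite V0 addr0.
(* Summation by parts: the boundary term [W N * (V n - V N)] of the partial sums vanishes at
   [N = n]. *)
suff H N : (N <= n)%N -> \sum_(i < N) (W i.+1 - W i) * (V n - V i - V i.+1)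
    = \sum_(i < N) (W i * V i.+1 - W i.+1 * V i) + W N * V n - W N * V N.
  by rewrite H // addrK.
elim: N => [|N IH] le; first by rewrite !big_ord0 W0; ring.
by rewrite !big_ord_recr /= IH 1?ltnW //; ring.
Qed.

(** * Explicit kernel sequences and their area form *)

Definition per3 (T : Type) (x y z : T) (i : nat) : T :=
  if (i %% 3 == 0)%N then x else if (i %% 3 == 1)%N then y else z.

(** The shared indices [m] and [k.+1] go to the outer blocks. For the [k] used below, [k.+1 - m] is
    even, and the formulas agree there once [m] is 1 mod 3. *)
Definition null_seq (R : zmodType) (m k : nat) (a t : R) (i : nat) : R :=
  if (i <= m)%N then per3 0 a (t - a) i
  else if (i <= k)%N then (if odd (i - m) then t - a else a)
  else per3 a t (t - a) (i - k.+1).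

Lemma per3P (T : Type) (x y z : T) (i : nat) :
  [/\ (i %% 3 = 0)%N, per3 x y z i = x, per3 x y z i.+1 = y & per3 x y z i.+2 = z]
  \/ [/\ (i %% 3 = 1)%N, per3 x y z i = y, per3 x y z i.+1 = z & per3 x y z i.+2 = x]
  \/ [/\ (i %% 3 = 2)%N, per3 x y z i = z, per3 x y z i.+1 = x & per3 x y z i.+2 = y].
Proof.
rewrite /per3.
have [h|[h|h]] : (i %% 3 = 0 \/ i %% 3 = 1 \/ i %% 3 = 2)%N by lia.
- left; have -> : (i.+1 %% 3 = 1)%N by lia.
  have -> : (i.+2 %% 3 = 2)%N by lia.
  by rewrite h.
- right; left; have -> : (i.+1 %% 3 = 2)%N by lia.
  have -> : (i.+2 %% 3 = 0)%N by lia.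
  by rewrite h.
- right; right; have -> : (i.+1 %% 3 = 0)%N by lia.
  have -> : (i.+2 %% 3 = 1)%N by lia.
  by rewrite h.
Qed.

Section NullSeq.
Variables (R : comNzRingType) (m r : nat).
Let k := (m + r.*2).-1.
Let n := (m + m + r.*2)%N.

Lemma null_seq_lo (a t : R) i : (i <= m)%N -> null_seq m k a t i = per3 0 a (t - a) i.
Proof. by rewrite /null_seq => ->. Qed.

Hypothesis m1 : (m %% 3 = 1)%N.

Lemma null_seq_mid (a t : R) i :
  (m <= i)%N -> (i <= k.+1)%N -> null_seq m k a t i = if odd (i - m) then t - a else a.
Proof.
rewrite /null_seq => h1 h2; case: ifP => h3.
  have -> : i = m by lia.
  by rewrite subnn /= /per3 m1.
case: ifP => // h4; have -> : i = k.+1 by lia.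
by rewrite subnn /= /per3 /= ifF //; lia.
Qed.

Lemma null_seq_hi (a t : R) i :
  null_seq m k a t (i + k.+1) = per3 a t (t - a) i.
Proof.
have [->|i0] := posnP i.
  by rewrite add0n null_seq_mid ?ifF //; lia.
rewrite /null_seq ifF; last by lia.
by rewrite ifF ?addnK //; lia.
Qed.

Lemma null_seq_ker (a t : R) i : (i < n)%N ->
  null_seq m k a t (minn n (i + k).+1) + null_seq m k a t (i - k)
  = null_seq m k a t i + null_seq m k a t i.+1.
Proof.
move=> ltin.
have [him|him] := boolP (i < m)%N.
  have -> : minn n (i + k).+1 = (i + k.+1)%N by lia.
  have -> : (i - k = 0)%N by lia.
  rewrite null_seq_hi !null_seq_lo; try lia.
  rewrite /per3 /=.
  have [h|[h|h]] : (i %% 3 = 0 \/ i %% 3 = 1 \/ i %% 3 = 2)%N by lia.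
  - have -> : (i.+1 %% 3 = 1)%N by lia.
    by rewrite h /=; ring.
  - have -> : (i.+1 %% 3 = 2)%N by lia.
    by rewrite h /=; ring.
  - have -> : (i.+1 %% 3 = 0)%N by lia.
    by rewrite h /=; ring.
(* From row [m] on the window is clipped at [n = m + k.+1], which is position [m] of the last block,
   so the value there is [t]. *)
have -> : minn n (i + k).+1 = (m + k.+1)%N by lia.
rewrite null_seq_hi [per3 _ _ _ m]/per3 m1 /=.
have [hik|hik] := boolP (i <= k)%N.
  have -> : (i - k = 0)%N by lia.
  rewrite null_seq_lo // !null_seq_mid ?subSn; try lia.
  by rewrite /per3 /=; case: (odd _) => /=; ring.
have -> : i = ((i - k.+1) + k.+1)%N by lia.
set j := (i - k.+1)%N.
have -> : (j + k.+1 - k = j.+1)%N by lia.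
rewrite -addSn !null_seq_hi null_seq_lo; last by lia.
rewrite /per3.
have [h|[h|h]] : (j %% 3 = 0 \/ j %% 3 = 1 \/ j %% 3 = 2)%N by lia.
- have -> : (j.+1 %% 3 = 1)%N by lia.
  by rewrite h /=; ring.
- have -> : (j.+1 %% 3 = 2)%N by lia.
  by rewrite h /=; ring.
- have -> : (j.+1 %% 3 = 0)%N by lia.
  by rewrite h /=; ring.
Qed.

(** In units of [b * t - u * a], the steps of one period contribute 0, 1, 0 in the first block and
    1, 1, -1 in the last, while the middle steps alternate 1, -1. As [m] is 1 mod 3, the blocks give
    [m %/ 3], 0 and [m %/ 3 + 1]. *)
Lemma null_seq_area (a t b u : R) :
  \sum_(i < n) (null_seq m k b u i * null_seq m k a t i.+1
                - null_seq m k b u i.+1 * null_seq m k a t i)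
  = (m %/ 3).*2.+1%:R * (b * t - u * a).
Proof.
set V := null_seq m k a t; set W := null_seq m k b u.
pose f i := W i * V i.+1 - W i.+1 * V i; rewrite -/(f _).
have lo N : (N <= m)%N -> \sum_(i < N) f i = (N.+1 %/ 3)%:R * (b * t - u * a).
  elim: N => [|N IH] leN; first by rewrite big_ord0 mul0r.
  rewrite big_ord_recr /= IH 1?ltnW // /f /V /W !null_seq_lo; try lia.
  rewrite /per3.
  have [h|[h|h]] : (N %% 3 = 0 \/ N %% 3 = 1 \/ N %% 3 = 2)%N by lia.
  - have -> : (N.+1 %% 3 = 1)%N by lia.
    rewrite h /=.
    have -> : (N.+2 %/ 3 = N.+1 %/ 3)%N by lia.
    by ring.
  - have -> : (N.+1 %% 3 = 2)%N by lia.
    rewrite h /=.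
    have -> : (N.+2 %/ 3 = (N.+1 %/ 3).+1)%N by lia.
    by rewrite -natr1; ring.
  - have -> : (N.+1 %% 3 = 0)%N by lia.
    rewrite h /=.
    have -> : (N.+2 %/ 3 = N.+1 %/ 3)%N by lia.
    by ring.
have mid N : (N <= r)%N -> \sum_(i < m + N.*2) f i = (m.+1 %/ 3)%:R * (b * t - u * a).
  elim: N => [|N IH] leN; first by rewrite addn0 lo.
  have -> : (m + N.+1.*2 = (m + N.*2).+2)%N by lia.
  rewrite !big_ord_recr /= IH 1?ltnW // /f /V /W !null_seq_mid; try lia.
  have -> : odd (m + N.*2 - m) = false by lia.
  have -> : odd ((m + N.*2).+1 - m) = true by lia.
  have -> : odd ((m + N.*2).+2 - m) = false by lia.
  by rewrite /=; ring.
(* The term [N %% 3] records the partial period: 1, 1, -1 has running sums 1, 2, 1. *)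
have hi N : (N <= m)%N -> \sum_(i < N + k.+1) f i
    = (m.+1 %/ 3)%:R * (b * t - u * a)
      + ((N %/ 3)%:R + (N %% 3)%:R) * (b * t - u * a).
  elim: N => [|N IH] leN.
    have -> : (0 + k.+1 = m + r.*2)%N by lia.
    by rewrite mid // addr0 mul0r addr0.
  rewrite addSn big_ord_recr /= IH 1?ltnW // /f /V /W -addSn !null_seq_hi /per3.
  have [h|[h|h]] : (N %% 3 = 0 \/ N %% 3 = 1 \/ N %% 3 = 2)%N by lia.
  - have -> : (N.+1 %% 3 = 1)%N by lia.
    rewrite h /=.
    have -> : (N.+1 %/ 3 = N %/ 3)%N by lia.
    by ring.
  - have -> : (N.+1 %% 3 = 2)%N by lia.
    rewrite h /=.
    have -> : (N.+1 %/ 3 = N %/ 3)%N by lia.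
    by ring.
  - have -> : (N.+1 %% 3 = 0)%N by lia.
    rewrite h /=.
    have -> : (N.+1 %/ 3 = (N %/ 3).+1)%N by lia.
    by rewrite -natr1; ring.
have -> : n = (m + k.+1)%N by lia.
rewrite hi // m1; have -> : (m.+1 %/ 3 = m %/ 3)%N by lia.
by rewrite -[in RHS]natr1 -addnn natrD; ring.
Qed.

End NullSeq.

(** * Classification of the solutions of the kernel equations *)

Lemma ker_seq_null (R : comNzRingType) (m r : nat) (V : nat -> R) :
  let k := (m + r.*2).-1 in let n := (m + m + r.*2)%N in
  V 0%N = 0 -> (0 < n)%N ->
  (forall i, (i < n)%N -> V (minn n (i + k).+1) + V (i - k)%N = V i + V i.+1) ->
  (forall i, (i <= n)%N -> V i = 0) \/
  (m %% 3 = 1)%N /\ (forall i, (i <= n)%N -> V i = null_seq m k (V 1%N) (V n) i).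
Proof.
move=> k n V0 n0 E.
have E1 i : (i < m)%N -> V (i + k.+1)%N = V i + V i.+1.
  move=> h; have /E : (i < n)%N by lia.
  have -> : minn n (i + k).+1 = (i + k.+1)%N by lia.
  have -> : (i - k = 0)%N by lia.
  by rewrite V0 addr0.
have E2 j : (j < m)%N -> V j.+1 + V n = V (j + k.+1)%N + V (j.+1 + k.+1)%N.
  move=> h; have /E : (j + k.+1 < n)%N by lia.
  have -> : minn n (j + k.+1 + k).+1 = n by lia.
  have -> : (j + k.+1 - k = j.+1)%N by lia.
  by rewrite addrC addSn.
have E3 i : (m <= i <= k)%N -> V n = V i + V i.+1.
  move=> h; have /E : (i < n)%N by lia.
  have -> : minn n (i + k).+1 = n by lia.
  have -> : (i - k = 0)%N by lia.
  by rewrite V0 addr0.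
have mid i : (i <= r.*2)%N -> V (m + i)%N = if odd i then V n - V m else V m.
  elim: i => [|i IH] h; first by rewrite addn0.
  have -> : V (m + i.+1)%N = V n - V (m + i)%N.
    by rewrite (E3 (m + i)%N) ?addnS; [ring | lia].
  by rewrite IH 1?ltnW //=; case: (odd i) => /=; ring.
(* If [m = 0], the alternation covers all of [[0,n]] and starts at 0; the even length [r.*2] then
   forces [V n = 0]. *)
have [m0|m0] := posnP m.
  left; have Vn : V n = 0.
    by have := mid r.*2 (leqnn _); rewrite odd_double /= m0 V0 /n m0.
  move=> i hi; have := mid i; rewrite {1}m0 add0n => ->; last by lia.
  by rewrite Vn m0 V0 subr0; case: ifP.
have Vk : V k.+1 = V m.
  have -> : k.+1 = (m + r.*2)%N by lia.
  by rewrite mid // odd_double.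
have Vm : V m = V 1%N by rewrite -Vk; have := E1 0%N m0; rewrite add0n V0 add0r.
(* Eliminating the last block between [E1] and [E2] shows that three consecutive values sum to
   [V n], whence period 3. *)
have E4 j : (j.+1 < m)%N -> V j.+2 = V n - V j - V j.+1.
  move=> h; have := E2 j (ltnW h); rewrite !E1 ?(ltnW h) // => e.
  have -> : V n = V j + V j.+1 + (V j.+1 + V j.+2) - V j.+1 by rewrite -e; ring.
  by ring.
have Vm1 : V m.-1 = 0.
  have ltm : (m.-1 < m)%N by lia.
  have := E2 _ ltm; rewrite E1 // prednK //.
  have -> : (m + k.+1 = n)%N by lia.
  by move=> /addIr /esym /eqP; rewrite -subr_eq0 addrK => /eqP.
have lo i : (i <= m)%N -> V i = per3 0 (V 1%N) (V n - V 1%N) i.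
  suff H j : ((j <= m)%N -> V j = per3 0 (V 1%N) (V n - V 1%N) j)
      /\ ((j.+1 <= m)%N -> V j.+1 = per3 0 (V 1%N) (V n - V 1%N) j.+1) by have [] := H i.
  elim: j => [|j [IH1 IH2]]; first by rewrite V0.
  split=> // h; rewrite E4 // IH1 ?IH2; try lia.
  case: (per3P 0 (V 1%N) (V n - V 1%N) j) => [|[]] [_ -> -> ->]; ring.
have Z : V 1%N = 0 -> V n = 0 -> forall i, (i <= n)%N -> V i = 0.
  move=> z1 zn.
  have zlo i : (i <= m)%N -> V i = 0.
    by move=> /lo ->; rewrite z1 zn subr0 /per3; case: ifP => //; case: ifP.
  move=> i hi; have [/zlo //|him] := boolP (i <= m)%N.
  have [hik|hik] := boolP (i <= k.+1)%N.
    have -> : i = (m + (i - m))%N by lia.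
    by rewrite mid ?Vm ?z1 ?zn ?subr0; [case: ifP | lia].
  have [->//|hin] := eqVneq i n.
  have -> : i = (i - k.+1 + k.+1)%N by lia.
  by rewrite E1 ?zlo ?addr0 //; lia.
(* The constraints [V m = V 1] and [V m.-1 = 0] remain. Against the period they are automatic for
   residue 1 and give [V 1 = V n = 0] for residues 0 and 2. *)
have [h|[h|h]] : (m %% 3 = 1 \/ m %% 3 = 0 \/ m %% 3 = 2)%N by lia.
- right; split=> // i hi.
  have [him|him] := boolP (i <= m)%N; first by rewrite null_seq_lo // lo.
  have [hik|hik] := boolP (i <= k.+1)%N.
    rewrite null_seq_mid //; last by lia.
    by rewrite -Vm -mid; [congr V; lia | lia].
  have -> : i = (i - k.+1 + k.+1)%N by lia.
  rewrite null_seq_hi //; have [->|hin] := eqVneq i n.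
    have -> : (n - k.+1 = m)%N by lia.
    have -> : (m + k.+1 = n)%N by lia.
    by rewrite /per3 h.
  set j := (i - k.+1)%N.
  rewrite E1 ?(lo j) ?(lo j.+1); try lia.
  rewrite /per3.
  have [g|[g|g]] : (j %% 3 = 0 \/ j %% 3 = 1 \/ j %% 3 = 2)%N by lia.
  + have -> : (j.+1 %% 3 = 1)%N by lia.
    by rewrite g /=; ring.
  + have -> : (j.+1 %% 3 = 2)%N by lia.
    by rewrite g /=; ring.
  + have -> : (j.+1 %% 3 = 0)%N by lia.
    by rewrite g /=; ring.
- left; apply: Z.
    by rewrite -Vm lo // /per3 h.
  have := Vm1; rewrite lo; last by lia.
  have := Vm; rewrite lo // /per3 h /= => <-.
  have -> : (m.-1 %% 3 = 2)%N by lia.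
  by rewrite /= subr0.
- have z1 : V 1%N = 0.
    have := Vm1; rewrite lo /per3; last by lia.
    by have -> : (m.-1 %% 3 = 1)%N by lia.
  left; apply: Z => //.
  by have := Vm; rewrite lo // /per3 h /= z1 subr0.
Qed.

(** * Nondegeneracy on the kernel and the multiplicity at 0 *)

Lemma tr_Amx (R : pzRingType) (n k : nat) (x : R) : (Amx n k x)^T = - Amx n k x.
Proof.
by apply/matrixP => i j; rewrite !mxE; case: ltngtP => // _; rewrite ?opprK ?oppr0.
Qed.

Lemma Amx0_pairing_nondegenerate (F : numFieldType) (m r : nat) (w : 'cV[F]_(m + m + r.*2)) :
  let n := (m + m + r.*2)%N in let k := (m + r.*2).-1 in
  Amx n k 0 *m w = 0 ->
  (forall v : 'cV_n, Amx n k 0 *m v = 0 -> v^T *m Amx n n 0 *m w = 0) -> w = 0.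
Proof.
move=> n k Aw pair0.
have [n0|n_gt0] := posnP n.
  by apply/matrixP => i j; have := ltn_ord i; lia.
pose V (i : nat) := \sum_(j < n | (j < i)%N) w j 0.
have wV : w = diff_col n V by exact: diff_colE.
have V0 : V 0%N = 0 by exact: big_pred0.
have KV i : (i < n)%N -> V (minn n (i + k).+1) + V (i - k)%N = V i + V i.+1.
  move=> ltin; apply/eqP; rewrite -subr_eq0 opprD addrA; apply/eqP.
  by rewrite -(Amx0_diff_col k V (Ordinal ltin)) -wV Aw mxE.
suff VZ : forall i, (i <= n)%N -> V i = 0.
  by apply/matrixP => i j; rewrite wV !mxE !VZ ?subrr // ltnW.
case: (ker_seq_null V0 n_gt0 KV) => [VZ|[m1 VE]]; first exact: VZ.
(* Pairing with the kernel vector of parameters [b], [u] gives an odd natural number times this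
   expression; that factor is nonzero in characteristic 0. *)
have zero b u : b * V n - u * V 1%N = 0.
  pose W := null_seq m k b u.
  have W0 : W 0%N = 0 by rewrite /W null_seq_lo.
  have AW : Amx n k 0 *m diff_col n W = 0.
    apply/matrixP => p q; rewrite ord1 Amx0_diff_col null_seq_ker // mxE.
    by rewrite -addrA -opprD subrr.
  have := congr1 (fun M : 'M_1 => M 0 0) (pair0 _ AW).
  rewrite wV pair_diff_col // mxE.
  rewrite (eq_bigr (fun i : 'I_n => W i * null_seq m k (V 1%N) (V n) i.+1
      - W i.+1 * null_seq m k (V 1%N) (V n) i)) => [|i _]; last by rewrite (VE i.+1) ?(VE i) // ltnW.
  rewrite null_seq_area // => /eqP; rewrite mulf_eq0 pnatr_eq0 /= => /eqP; exact.
have Vn : V n = 0 by have := zero 1 0; rewrite mul1r mul0r subr0.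
have V1 : V 1%N = 0 by have /eqP := zero 0 1; rewrite mul1r mul0r sub0r oppr_eq0 => /eqP.
move=> i /VE ->; rewrite V1 Vn /null_seq /per3 subrr.
by do ![case: ifP => //].
Qed.

(** [Amx n n 0] is the sign matrix, so the difference vanishes on the first [k] superdiagonals and
    is -1 beyond them. Passing to [rat] provides the field needed for ranks. *)
Lemma map_Amx_pencil (n k : nat) :
  map_mx (map_poly (intr : int -> rat)) (Amx n k 'X)
  = map_mx polyC (Amx n k 0) + 'X *: map_mx polyC (Amx n k 0 - Amx n n 0).
Proof.
apply/matrixP => i j; rewrite !mxE /sup_entry.
case: ltngtP => [lij|lji|_]; last by rewrite subrr rmorph0 mulr0 addr0 rmorph0.
  have -> : (j - i <= n)%N by have := ltn_ord j; lia.
  case: ifP => _; first by rewrite subrr rmorph0 mulr0 addr0 !rmorph1.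
  by rewrite rmorphN /= map_polyX oppr0 sub0r polyCN polyC1 polyC0; ring.
have -> : (i - j <= n)%N by have := ltn_ord i; lia.
case: ifP => _; first by rewrite subrr rmorph0 mulr0 addr0 !rmorphN !rmorph1.
by rewrite opprK /= map_polyX !oppr0 opprK add0r polyC1; ring.
Qed.

Theorem theorem9p2 (nu k : nat) :
  (k <= 2 * nu - 1)%N -> (nu - 1 <= k)%N -> (1 <= nu - 1)%N ->
  Dpoly (2 * nu) k != 0 /\
  mup 0 (map_poly (intr : int -> rat) (Dpoly (2 * nu) k)) = Nnull (2 * nu) k.
Proof.
move=> lek gek nu1.
(* [m] counts the superdiagonals filled with [-x], and [r] is half of [k.+1 - m]; the bounds on [k]
   make both subtractions exact. *)
pose m := (2 * nu - 1 - k)%N; pose r := (k.+1 - nu)%N.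
have -> : (2 * nu = m + m + r.*2)%N by lia.
have -> : k = (m + r.*2).-1 by lia.
move: m r => m r; set n := (m + m + r.*2)%N; set l := (m + r.*2).-1.
have [] := @mup_det_pencil _ n (Amx n l 0 : 'M[rat]_n) (Amx n l 0 - Amx n n 0) _.
  move=> w Aw pair0; apply: Amx0_pairing_nondegenerate Aw _ => v Av.
  (* Skew-symmetry turns right kernel vectors into left ones, which also kills the [Amx n l 0] part
     of the pairing and leaves minus the sign form. *)
  have vA : v^T *m Amx n l 0 = 0.
    by apply: (can_inj (@trmxK _ _ _)); rewrite trmx_mul trmxK tr_Amx mulNmx Av oppr0 trmx0.
  have := pair0 _ vA; rewrite mulmxBr vA sub0r mulNmx => /eqP.
  by rewrite oppr_eq0 => /eqP.
rewrite -map_Amx_pencil det_map_mx -/(Dpoly n l) => nzD mupD; split; last exact: mupD.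
by apply: contraNneq nzD => ->; rewrite rmorph0.
Qed.
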